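(* For every integer $k\ge 0$ there is an integer $R_k$, not depending on $q$, such that for every prime power $q$ and every integer $r\ge R_k$, \[ \mathrm{ex}_q(r,k)=\begin{cases}\binom{r+1}{k} & \text{if } q=2 \text{ and } k \text{ is even},\\[2pt] \binom{r}{k}(q-1)^k & \text{otherwise.}\end{cases} \]
   Context: $F_q$ is the finite field with $q$ elements. The weight of a vector is its number of nonzero entries. $\mathrm{ex}_q(r,k)$ denotes the maximum number of distinct columns of a matrix over $F_q$ (with any number of rows) such that every column has weight exactly $k$ and the matrix has rank at most $r$. *)

(* Defs.v *)
From mathcomp Require Import all_boot all_order all_algebra.
From mathcomp Require Import boolp.
Set Implicit Arguments.
Unset Strict Implicit.
Unset Printing Implicit Defensive.
Import GRing.Theory.

Local Open Scope nat_scope.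

Definition weight (F : finFieldType) (m : nat) (v : 'cV[F]_m) : nat :=
  #|[set i : 'I_m | v i 0%R != 0%R]|.

Definition columns (F : finFieldType) (m n : nat) (A : 'M[F]_(m, n)) :
  {set 'cV[F]_m} := [set col j A | j : 'I_n].

(* Repeated columns of A are counted once. Nothing bounds m, so attainable is
   made boolean below by classical decidability. *)
Definition attainable (F : finFieldType) (r k N : nat) : Prop :=
  exists m n (A : 'M[F]_(m, n)),
    [/\ forall j : 'I_n, weight (col j A) = k,
        \rank A <= r
      & #|columns A| = N].

Lemma card_columns (F : finFieldType) (m n : nat) (A : 'M[F]_(m, n)) :
  #|columns A| <= #|F| ^ \rank A.
Proof.
have sub : columns A \subset
    [set (col_base A *m w)%R | w : 'cV[F]_(\rank A)].
  apply/subsetP => _ /imsetP[j _ ->]; apply/imsetP.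
  exists (col j (row_base A)) => //.
  by rewrite -[in LHS](mulmx_base A) !colE mulmxA.
apply: leq_trans (subset_leq_card sub) _.
apply: leq_trans (leq_imset_card _ _) _.
by rewrite card_mx muln1.
Qed.

Lemma attainable0 (F : finFieldType) (r k : nat) :
  exists N, `[< attainable F r k N >].
Proof.
exists 0; apply/asboolP; exists 0, 0, 0%R; split.
- by case.
- by rewrite mxrank0.
- by apply/eqP; rewrite -leqn0 (leq_trans (leq_imset_card _ _)) // card_ord.
Qed.

Lemma attainable_bound (F : finFieldType) (r k N : nat) :
  `[< attainable F r k N >] -> N <= #|F| ^ r.
Proof.
move=> /asboolP[m [n [A [_ rA <-]]]]; apply: leq_trans (card_columns A) _.
by rewrite leq_pexp2l //; apply/card_gt0P; exists 0%R.
Qed.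

(* The largest attainable N; it exists because a matrix of rank at most r over
   F has at most #|F| ^ r distinct columns. *)
Definition ex (F : finFieldType) (r k : nat) : nat :=
  ex_maxn (attainable0 F r k) (@attainable_bound F r k).

(* Main.v *)
Require Import Defs.
From mathcomp Require Import all_boot all_order all_algebra.
From mathcomp Require Import boolp zify.

(* Choosing rank-many independent rows of the matrix (and padding with zeros)
   turns the columns into vectors x of F^r with weight x + weight (B x) = k for
   some matrix B. Compare this set with the sphere of radius k: it misses the
   "live" vectors of weight k, those with B x != 0, and gains only live vectors
   of smaller weight.

   If q > 2, or if q = 2 and no nonzero vector fills more than half of the
   columns of B, every live vector of weight j < k has at least 2k positions
   where it can be extended to a live vector of weight j + 1, so the numbers of
   live vectors at least double from each weight to the next and the loss
   exceeds the gain. If q = 2, k is odd and a nonzero vector fills more than half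
   of the columns of B, then all weight-k vectors supported on these columns are
   live, a loss of order r^k against a gain of order r^(k-1). If q = 2 and k is
   even, the weight k - 1 may be gained completely, and two distinct columns of B
   already cost 'C(r - 2, k - 1), more than all weights below k - 1 can give;
   when all columns of B are equal, B x is 0 or a fixed vector, and the count is
   direct. *)

Set Implicit Arguments.
Unset Strict Implicit.
Unset Printing Implicit Defensive.
Import GRing.Theory.

Local Open Scope nat_scope.

(** * Comparison of sums of binomial coefficients *)

(** Raising [j] by one multiplies the two binomials by factors in ratio (r - j) / (n - j), which is
    at most 4 while 3j + 4 <= 2n. *)
Lemma leq_bin_shrink (r n j : nat) :
  r <= n.*2 + 4 -> 3 * j + 4 <= n.*2 -> 'C(r, j) <= 4 ^ j * 'C(n, j).
Proof.
move=> rn; elim: j => [|j IHj] jn; first by rewrite !bin0.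
have jn' : 3 * j + 4 <= n.*2 by lia.
rewrite -(leq_pmul2l (ltn0Sn j)) mulnCA !mul_bin_left.
apply: leq_trans (leq_mul (_ : r - j <= 4 * (n - j)) (IHj jn')) _; first by lia.
by rewrite expnS; lia.
Qed.

(** The bound on [r] gives n - s >= 2(s + 1)4^s for s < k, so 'C(n, s + 1) is at least twice 4^s
    'C(n, s). One half pays for 'C(r, s), the other for the earlier terms. *)
Lemma sum_bin_leq (k r n s : nat) :
  4 * k * 4 ^ k + 6 * k + 10 <= r -> r <= n.*2 + 4 -> s <= k ->
  \sum_(j < s) 'C(r, j) <= 'C(n, s).
Proof.
move=> rk rn; elim: s => [|s IHs] sk; first by rewrite big_ord0.
rewrite big_ord_recr /=.
have IH := IHs (ltnW sk).
have k1 : 1 <= k by apply: leq_trans sk.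
have C1 := @leq_bin_shrink r n s rn ltac:(lia).
have e1 : 1 <= 4 ^ s by rewrite expn_gt0.
have e2 : 4 ^ s <= 4 ^ k by rewrite leq_exp2l // ltnW.
have C2 : 2 * 4 ^ s * 'C(n, s) <= 'C(n, s.+1).
  rewrite -(leq_pmul2l (ltn0Sn s)) mul_bin_left mulnA leq_mul2r.
  apply/orP; right.
  have : s.+1 * 4 ^ s <= k * 4 ^ k by apply: leq_mul.
  lia.
apply: leq_trans C2; rewrite -mulnA mul2n -addnn leq_add //.
by apply: leq_trans IH (leq_pmull _ _).
Qed.

Lemma doubling_sum_leq (g : nat -> nat) (k : nat) :
  (forall j, j < k -> 2 * g j <= g j.+1) -> \sum_(j < k) g j <= g k.
Proof.
elim: k => [|k IHk] H; first by rewrite big_ord0.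
rewrite big_ord_recr /=.
apply: leq_trans (H k (ltnSn k)); rewrite mul2n -addnn leq_add2r.
by apply: IHk => j jk; apply: H; apply: ltnW.
Qed.

(** * Supports, and counting vectors by weight *)

Section Support.
Context {F : finFieldType} {r : nat}.
Implicit Types (x y : 'cV[F]_r) (i : 'I_r) (D S : {set 'I_r}).

Definition supp x : {set 'I_r} := [set i | x i 0%R != 0%R].

Lemma weightE x : weight x = #|supp x|.
Proof. by []. Qed.

Lemma weight_eq0 x : (weight x == 0) = (x == 0%R).
Proof.
rewrite weightE cards_eq0; apply/eqP/eqP => [x0|->]; last first.
  by apply/setP => i; rewrite !inE mxE eqxx.
apply/colP => i; rewrite mxE; apply/eqP/negPn/negP => xi.
by have := in_set0 i; rewrite -x0 inE xi.
Qed.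

Lemma card_supp_eq S :
  #|[set x : 'cV[F]_r | supp x == S]| = (#|F| - 1) ^ #|S|.
Proof.
pose g (f : {ffun 'I_r -> F}) : 'cV[F]_r := (\col_i f i)%R.
have g_inj : injective g.
  by move=> f h /colP E; apply/ffunP => i; have := E i; rewrite !mxE.
(* Functions that vanish off [S] and take nonzero values on [S]. *)
have -> : [set x | supp x == S] = g @: (pffun_on 0%R S (predC1 0%R)).
  apply/setP => x; rewrite inE; apply/eqP/imsetP => [<-|[f /pffun_onP[f1 f2] ->]].
    exists [ffun i => x i 0%R]; last by apply/colP => i; rewrite !mxE ffunE.
    apply/pffun_onP; split=> [|_ /imageP[i xi ->]].
      by apply/supportP => i; rewrite inE negbK ffunE => /eqP.
    by move: xi; rewrite !inE ffunE.
  apply/setP => i; rewrite inE mxE; apply/idP/idP => [fi|iS].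
    by move/subsetP: f1 => /(_ i); apply; rewrite inE.
  by have /f2 := image_f f iS; rewrite !inE.
by rewrite card_imset // card_pffun_on cardC1 subn1.
Qed.

Lemma card_supp_sub D j :
  #|[set x : 'cV[F]_r | (supp x \subset D) && (weight x == j)]|
  = 'C(#|D|, j) * (#|F| - 1) ^ j.
Proof.
rewrite -sum1_card.
rewrite (partition_big supp [pred S : {set 'I_r} | (S \subset D) && (#|S| == j)])
  => [|x]; last by rewrite inE.
rewrite (eq_bigr (fun=> (#|F| - 1) ^ j)) => [|S /andP[SD /eqP Sj]]; last first.
  rewrite -Sj -card_supp_eq -[RHS]sum1_card; apply: eq_bigl => x; rewrite !inE.
  by case: (eqVneq (supp x) S) => [E|]; rewrite ?andbF // weightE E SD eqxx.
by rewrite sum_nat_cond_const -cards_draws cardsE.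
Qed.

Lemma card_sphere j :
  #|[set x : 'cV[F]_r | weight x == j]| = 'C(r, j) * (#|F| - 1) ^ j.
Proof.
have := card_supp_sub setT j; rewrite cardsT card_ord => <-.
by apply: eq_card => x; rewrite !inE subsetT.
Qed.

Definition upd x i (c : F) : 'cV[F]_r :=
  (\col_l if l == i then c else x l 0)%R.

Lemma upd_id x i c d : x i 0%R = c -> upd (upd x i d) i c = x.
Proof. by move=> xi; apply/colP => l; rewrite !mxE; case: eqP => // ->. Qed.

Lemma supp_upd x i c : c != 0%R -> supp (upd x i c) = i |: supp x.
Proof. by move=> c0; apply/setP => l; rewrite !inE mxE; case: (eqVneq l i). Qed.

Lemma weight_upd x i c :
  x i 0%R = 0%R -> c != 0%R -> weight (upd x i c) = (weight x).+1.
Proof. by move=> xi c0; rewrite !weightE supp_upd // cardsU1 inE xi eqxx. Qed.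

Lemma mulmx_upd p (B : 'M[F]_(p, r)) x i c : x i 0%R = 0%R ->
  (B *m upd x i c = B *m x + c *: col i B)%R.
Proof.
move=> xi; apply/colP => l; rewrite !mxE (bigD1 i) //= [in RHS](bigD1 i) //=.
rewrite !mxE eqxx xi mulr0 add0r addrC mulrC; congr (_ + _)%R.
by apply: eq_bigr => j /negPf ji; rewrite mxE ji.
Qed.

End Support.

Lemma card_by_weight (F : finFieldType) (r s : nat) (A : {set 'cV[F]_r})
    (g : nat -> nat) :
  (forall x, x \in A -> weight x < s) ->
  (forall j, j < s -> #|[set x in A | weight x == j]| <= g j) ->
  #|A| <= \sum_(j < s) g j.
Proof.
case: s => [|s] As Ag.
  by rewrite big_ord0 leqn0 cards_eq0; apply/eqP/setP => x; rewrite inE;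
    apply/negP => /As.
rewrite -sum1_card (partition_big (fun x => inord (weight x) : 'I_s.+1) predT) //=.
apply: leq_sum => j _; apply: leq_trans (Ag j (ltn_ord j)).
rewrite -sum1_card; apply/eq_leq/eq_bigl => x; rewrite !inE.
by case: (boolP (x \in A)) => //= /As xs; rewrite -val_eqE /= inordK.
Qed.

(** * Solutions and live vectors of a fixed matrix *)

Section Solutions.
Context {F : finFieldType} {p r : nat} (B : 'M[F]_(p, r)).
Implicit Types (x y : 'cV[F]_r) (i : 'I_r).

Definition sol (k : nat) : {set 'cV[F]_r} :=
  [set x | weight x + weight (B *m x)%R == k].

Definition live (j : nat) : {set 'cV[F]_r} :=
  [set x | (weight x == j) && (B *m x != 0)%R].

(** The cutoff [s] is separate from [k] because the even binary case treats weight k - 1 apart. *)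
Definition low (k s : nat) : {set 'cV[F]_r} := [set x in sol k | weight x < s].

(** A solution of weight [k] has B x = 0, and the sphere splits into such vectors and live ones; all
    other solutions are low. Adding the live vectors on the left avoids truncated subtraction. *)
Lemma sol_live k :
  #|sol k| + #|live k| <= 'C(r, k) * (#|F| - 1) ^ k + #|low k k|.
Proof.
pose dead := [set x : 'cV[F]_r | (weight x == k) && (B *m x == 0)%R].
have -> : 'C(r, k) * (#|F| - 1) ^ k = #|dead| + #|live k|.
  rewrite -card_sphere -(cardsID [set x | B *m x == 0]%R).
  by congr (_ + _); apply: eq_card => x; rewrite !inE // andbC.
rewrite addnAC leq_add2r; apply: leq_trans (leq_card_setU _ _).
apply/subset_leq_card/subsetP => x; rewrite !inE => xk.
rewrite xk /= -[_ == 0%R]weight_eq0; lia.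
Qed.

Lemma low_live k : #|low k k| <= \sum_(j < k) #|live j|.
Proof.
apply: (@card_by_weight _ _ _ _ (fun j => #|live j|))
  => [x|j jk]; first by rewrite inE => /andP[].
apply/subset_leq_card/subsetP => x; rewrite !inE.
rewrite -[_ == 0%R]weight_eq0; lia.
Qed.

Lemma low_bin k s : #|low k s| <= \sum_(j < s) 'C(r, j) * (#|F| - 1) ^ j.
Proof.
apply: (@card_by_weight _ _ _ _ (fun j => 'C(r, j) * (#|F| - 1) ^ j))
  => [x|j js]; first by rewrite inE => /andP[].
rewrite -card_sphere; apply/subset_leq_card/subsetP => x.
by rewrite !inE => /andP[].
Qed.

(* Double counting of the pairs (x, i), x live of weight j, such that x can be
   altered at the zero position i into a live vector of weight j + 1. *)
Lemma live_step j d :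
  (forall x, x \in live j -> d <= #|[set i | (x i 0 == 0)%R &&
     [exists c : F, (c != 0) && (B *m x + c *: col i B != 0)]%R]|) ->
  d * #|live j| <= j.+1 * #|live j.+1|.
Proof.
move=> H.
pose ok x i := [pred c : F | (c != 0) && (B *m x + c *: col i B != 0)]%R.
pose I x := [set i | (x i 0 == 0)%R && [exists c, ok x i c]].
(* The default 0 never occurs for [i] in [I x]. *)
pose c x i : F := odflt 0%R [pick c | ok x i c].
have cP x i : i \in I x ->
    [/\ x i 0 = 0, c x i != 0 & B *m x + c x i *: col i B != 0]%R.
  rewrite inE => /andP[/eqP xi /existsP[a a_ok]]; rewrite /c.
  by case: pickP => [b /andP[]|/(_ a)]; rewrite ?a_ok.
pose P1 := [set z : 'cV[F]_r * 'I_r | (z.1 \in live j) && (z.2 \in I z.1)].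
pose P2 := [set z : 'cV[F]_r * 'I_r | (z.1 \in live j.+1) && (z.2 \in supp z.1)].
have cardP (A : {set 'cV[F]_r}) (J : 'cV[F]_r -> {set 'I_r}) :
    #|[set z | (z.1 \in A) && (z.2 \in J z.1)]| = \sum_(x in A) #|J x|.
  rewrite -sum1_card; under [RHS]eq_bigr do rewrite -sum1_card.
  by rewrite pair_big_dep; apply: eq_bigl => -[x i]; rewrite inE.
have leP1 : d * #|live j| <= #|P1|.
  by rewrite mulnC -sum_nat_const cardP; apply: leq_sum => x /H.
have P2E : #|P2| = j.+1 * #|live j.+1|.
  rewrite mulnC -sum_nat_const cardP; apply: eq_bigr => x.
  by rewrite inE => /andP[/eqP <-].
rewrite -P2E; apply: leq_trans leP1 _.
(* Injective on [P1]: resetting the recorded position to 0 recovers the vector. *)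
pose f (z : 'cV[F]_r * 'I_r) := (upd z.1 z.2 (c z.1 z.2), z.2).
rewrite -(@card_in_imset _ _ f P1).
  apply/subset_leq_card/subsetP => _ /imsetP[[x i] + ->].
  rewrite inE /= => /andP[+ /cP[xi c0 Bc]].
  rewrite !inE /= => /andP[/eqP xj _].
  by rewrite weight_upd // mulmx_upd // mxE xj !eqxx Bc c0.
move=> [x i] [y l]; rewrite inE /= => /andP[_ /cP[xi _ _]].
rewrite inE /= => /andP[_ /cP[yl _ _]] [E il]; rewrite -il in E yl *.
by rewrite -(upd_id (c x i) xi) E (upd_id _ yl).
Qed.

(** By [live_step], 2k times the number of live vectors of weight j < k is at most j + 1 <= k times
    that of weight j + 1. So the numbers double, and the live vectors of weight [k] outnumber the
    low solutions. *)
Lemma sol_doubling k d : 2 * k <= d ->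
  (forall x j, j < k -> x \in live j -> d <= #|[set i | (x i 0 == 0)%R &&
     [exists c : F, (c != 0) && (B *m x + c *: col i B != 0)]%R]|) ->
  #|sol k| <= 'C(r, k) * (#|F| - 1) ^ k.
Proof.
move=> kd H; rewrite -(leq_add2r #|live k|).
apply: leq_trans (sol_live k) _; rewrite leq_add2l.
apply: leq_trans (low_live k) (@doubling_sum_leq (fun j => #|live j|) _ _).
move=> j jk /=.
have k0 : 0 < k by apply: leq_trans jk.
rewrite -(leq_pmul2l k0) mulnA (mulnC k).
apply: leq_trans (leq_mul kd (leqnn _)) _.
by apply: leq_trans (live_step (fun x => H x j jk)) (leq_mul jk (leqnn _)).
Qed.

(** For [x] of weight [k] vanishing at [i1] and [i2], putting a 1 at [i1] or at [i2] gives two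
    different images under [B], so one of them is nonzero. Clearing both positions recovers [x]. *)
Lemma live_col_neq i1 i2 k : col i1 B != col i2 B ->
  'C(r - 2, k) * (#|F| - 1) ^ k <= #|live k.+1|.
Proof.
move=> neq.
have i12 : i1 != i2 by apply: contraNneq neq => ->.
pose D := ~: [set i1; i2].
have -> : r - 2 = #|D|.
  by have := cardsC [set i1; i2]; rewrite cards2 i12 card_ord -/D; lia.
rewrite -card_supp_sub; set S := [set x | _].
have SP x : x \in S -> [/\ x i1 0 = 0, x i2 0 = 0 & weight x = k]%R.
  rewrite inE => /andP[/subsetP xD /eqP xk].
  split=> //; apply/eqP/negPn/negP => xi.
    by have := xD i1; rewrite !inE xi eqxx => /(_ isT).
  by have := xD i2; rewrite !inE xi eqxx orbT => /(_ isT).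
pose f x := if (B *m upd x i1 1 != 0)%R then upd x i1 1%R else upd x i2 1%R.
have fK x : x \in S -> upd (upd (f x) i1 0%R) i2 0%R = x.
  move=> /SP[x1 x2 _]; rewrite /f; case: ifP => _; apply/colP => l; rewrite !mxE;
    by do 2!case: eqP => [->|_] //.
rewrite -(@card_in_imset _ _ f S) => [|x y xS yS E]; last first.
  by rewrite -(fK x xS) E fK.
apply/subset_leq_card/subsetP => _ /imsetP[x /SP[x1 x2 xk] ->].
rewrite inE /f; case: ifPn => [Bx|]; rewrite weight_upd ?oner_neq0 // xk eqxx //.
rewrite negbK !mulmx_upd // !scale1r => /eqP E.
by apply: contraNneq neq => E2; apply/eqP/(addrI (B *m x)%R); rewrite E E2.
Qed.

Lemma mulmx_const_col (D : {set 'I_r}) (e : 'cV[F]_p) x :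
  supp x \subset D -> {in D, forall i, col i B = e} ->
  (B *m x = (\sum_i x i 0) *: e)%R.
Proof.
move=> /subsetP xD De; apply/colP => l; rewrite !mxE mulr_suml.
apply: eq_bigr => i _; have [->|xi] := eqVneq (x i 0%R) 0%R.
  by rewrite mulr0 mul0r.
rewrite mulrC -(De i) ?mxE //; apply: xD; by rewrite inE.
Qed.

End Solutions.

(** * Parity over the field with two elements *)

Section Binary.
Variable F : finFieldType.
Hypothesis F2 : #|F| = 2.

Lemma F2_eq1 (a : F) : a != 0%R -> a = 1%R.
Proof.
move=> a0; apply/eqP/negPn/negP => a1.
have := subset_leq_card (subsetT [set 0%R; 1%R; a]).
rewrite cardsT F2 -setUA cardsU1 !inE cards2 eq_sym oner_eq0 /=.
by rewrite eq_sym (negPf a0) eq_sym a1.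
Qed.

Lemma F2_natr n : (n%:R = (odd n)%:R :> F)%R.
Proof.
have two0 : (2%:R = 0 :> F)%R.
  apply/eqP/negPn/negP => /F2_eq1 /eqP.
  by rewrite -subr_eq0 mulrS addrK oner_eq0.
by rewrite -{1}(odd_double_half n) -muln2 natrD natrM two0 mulr0 addr0.
Qed.

Lemma F2_sum r (x : 'cV[F]_r) : (\sum_i x i 0 = (weight x)%:R)%R.
Proof.
rewrite weightE -sum1_card natr_sum [RHS]big_mkcond /=.
by apply: eq_bigr => i _; rewrite inE; case: eqP => // /eqP /F2_eq1.
Qed.

End Binary.

(** * Upper bounds on the number of solutions *)

Lemma card_setCU (T : finType) (U V : {set T}) :
  #|T| - (#|U| + #|V|) <= #|~: (U :|: V)|.
Proof. by rewrite -(cardsC (U :|: V)) leq_subLR leq_add2r leq_card_setU. Qed.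

Section Bounds.
Context {F : finFieldType} {p r : nat} (B : 'M[F]_(p, r)) (k : nat).
Hypothesis r_large : 4 * k * 4 ^ k + 6 * k + 10 <= r.

Lemma sol_le_large_field : #|F| != 2 -> #|sol B k| <= 'C(r, k) * (#|F| - 1) ^ k.
Proof.
move=> F2; apply: (@sol_doubling _ _ _ _ _ (r - k)) => [|x j jk]; first lia.
rewrite inE => /andP[/eqP xj Bx].
have [a] : exists a, a \notin [set 0%R; 1%R : F].
  suff /subsetPn[a _ aN] : ~~ ([set: F] \subset [set 0; 1]%R) by exists a.
  apply: contraNN F2 => /subset_leq_card; rewrite cardsT cards2 => F_le2.
  rewrite eqn_leq card_finNzRing_gt1 andbT; apply: leq_trans F_le2 _.
  by rewrite ltnS leq_b1.
rewrite !inE negb_or => /andP[a0 a1].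
apply: (@leq_trans #|~: supp x|).
  by have := cardsC (supp x); rewrite card_ord -weightE xj; lia.
apply/subset_leq_card/subsetP => i; rewrite !inE negbK => ->; apply/existsP.
have [E|N] := eqVneq (B *m x + 1 *: col i B)%R 0%R; last first.
  by exists 1%R; rewrite oner_neq0.
(* Since B x + col i B = 0, the new image is (a - 1) times [col i B], and col i B = 0 would force B
   x = 0. *)
exists a; rewrite a0 -[a](subrK 1%R) addrC scalerDl -addrA.
rewrite [(1 *: _ + _)%R]addrC E addr0.
rewrite scaler_eq0 subr_eq0 (negPf a1) /=.
by apply: contra_neq Bx => c0; rewrite c0 scaler0 addr0 in E.
Qed.

Hypothesis F2 : #|F| = 2.

Lemma card_low_binary l s : #|low B l s| <= \sum_(j < s) 'C(r, j).
Proof.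
apply: leq_trans (low_bin _ _ _) _; apply: leq_sum => j _.
by rewrite F2 exp1n muln1.
Qed.

Lemma sol_le_binary_odd : odd k -> #|sol B k| <= 'C(r, k) * (#|F| - 1) ^ k.
Proof.
move=> k_odd; pose D e := [set i | col i B == e].
have [/existsP[e /andP[e0 De]]|] :=
  boolP [exists e, (e != 0%R) && (r < #|D e|.*2)].
  rewrite -(leq_add2r #|live B k|); apply: leq_trans (sol_live _ _) _.
  rewrite leq_add2l; apply: leq_trans (card_low_binary _ _) _.
  apply: leq_trans (@sum_bin_leq k r #|D e| k _ _ _) _ => //; first lia.
  have := @card_supp_sub F r (D e) k; rewrite F2 exp1n muln1 => <-.
  (* On such [x] the matrix acts as weight times [e], which is [e] itself because [k] is odd. *)
  apply/subset_leq_card/subsetP => x; rewrite !inE => /andP[xD xk].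
  rewrite xk (mulmx_const_col (e := e) xD) => [|i]; last by rewrite inE => /eqP.
  by rewrite F2_sum // F2_natr // (eqP xk) k_odd scale1r.
rewrite negb_exists => /forallP D_small.
apply: (@sol_doubling _ _ _ _ _ (2 * k)) => // x j jk.
rewrite inE => /andP[/eqP xj Bx].
(* Over this field the only alteration adds [col i B]; it kills the image exactly when [col i B] is
   -B x, which happens for at most half of the positions. *)
have := D_small (- (B *m x))%R; rewrite oppr_eq0 Bx /= -leqNgt => Dx.
apply: (@leq_trans (r - (j + #|D (- (B *m x))%R|))).
  by move: Dx; move: #|D _| => n; lia.
have := card_setCU (supp x) (D (- (B *m x))%R).
rewrite card_ord -weightE xj => le; apply: leq_trans le _.
apply/subset_leq_card/subsetP => i; rewrite !inE negb_or negbK => /andP[-> N].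
by apply/existsP; exists 1%R; rewrite oner_neq0 scale1r addrC addr_eq0.
Qed.

Lemma sol_le_binary : #|sol B k| <= 'C(r.+1, k).
Proof.
have Wk : #|sol B k| + #|live B k| <= 'C(r, k) + #|low B k k|.
  by have := sol_live B k; rewrite F2 exp1n muln1.
case: k r_large Wk => [|k'] rk Wk.
  have := card_low_binary 0 0; rewrite big_ord0.
  rewrite !bin0 in Wk *; move: Wk.
  by move: #|sol _ _| #|low _ _ _| #|live _ _| => a b c; lia.
pose top := [set x : 'cV[F]_r | (weight x == k') && (weight (B *m x)%R == 1)].
have low_split : #|low B k'.+1 k'.+1| <= #|low B k'.+1 k'| + #|top|.
  apply: leq_trans (leq_card_setU _ _).
  by apply/subset_leq_card/subsetP => x; rewrite !inE; lia.
have low_le : #|low B k'.+1 k'| <= 'C(r - 2, k').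
  apply: leq_trans (card_low_binary _ _) _.
  by apply: (sum_bin_leq rk); lia.
have top_le : #|top| <= 'C(r, k').
  have := @card_sphere F r k'; rewrite F2 exp1n muln1 => <-.
  by apply/subset_leq_card/subsetP => x; rewrite !inE => /andP[].
(* By Pascal's rule the allowed excess over 'C(r, k) is 'C(r, k'), which [top] alone may use up. *)
rewrite binS.
have [/existsP[i1 /existsP[i2 neq]]|] :=
    boolP [exists i1, exists i2, col i1 B != col i2 B].
  by have := live_col_neq k' neq; rewrite F2 exp1n muln1; lia.
move=> /existsPn eqB.
have r0 : 0 < r by lia.
pose b := col (Ordinal r0) B.
have BE x : (B *m x = (\sum_i x i 0) *: b)%R.
  apply: (mulmx_const_col (D := setT)); first exact: subsetT.
  by move=> i _; have /existsPn/(_ (Ordinal r0)) := eqB i; rewrite negbK => /eqP.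
have wBx x : weight (B *m x)%R = 0 \/ weight (B *m x)%R = weight b.
  rewrite BE; have [->|/F2_eq1->//] := eqVneq (\sum_i x i 0)%R 0%R.
    by left; apply/eqP; rewrite weight_eq0 scale0r.
  by right; rewrite scale1r.
(* A solution of weight below [k'] needs an image of weight at least 2, and one in [top] an image of
   weight 1. Images have weight 0 or that of [b], so one of the two sets is empty. *)
have [b1|b1] := eqVneq (weight b) 1.
  suff : #|low B k'.+1 k'| = 0 by lia.
  apply/eqP; rewrite cards_eq0; apply/eqP/setP => x; rewrite !inE.
  by have [] := wBx x; lia.
have : #|top| = 0; last first.
  by have := leq_bin2l k' (leq_subr 2 r); lia.
apply/eqP; rewrite cards_eq0; apply/eqP/setP => x; rewrite !inE.
by have [] := wBx x; lia.
Qed.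

End Bounds.

(** * Reduction from matrices to solutions *)

Lemma weight_col_mx0 (F : finFieldType) m d (w : 'cV[F]_m) :
  weight (col_mx w (0 : 'cV_d))%R = weight w.
Proof.
rewrite !weightE -(card_imset _ (@lshift_inj m d)); apply: eq_card => i.
rewrite inE; apply/idP/imsetP => [|[l wl ->]]; last first.
  by rewrite col_mxEu; rewrite inE in wl.
case: (split_ordP i) => l ->.
  by rewrite col_mxEu => wl; exists l; rewrite ?inE.
by rewrite col_mxEd mxE eqxx.
Qed.

(** The entries of a column in a row basis of [A] determine the column linearly; they form [x], and
    the remaining entries form B x. *)
Lemma columns_sol (F : finFieldType) m n (A : 'M[F]_(m, n)) r k :
  (forall j, weight (col j A) = k) -> \rank A <= r ->
  exists B : 'M[F]_(m, r), #|columns A| <= #|sol B k|.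
Proof.
move=> Ak; move/subnKC <-; set d := r - _; move: d => d.
pose f := maxrankfun A.
have /submxP[C AE] : (A <= rowsub f A)%MS by rewrite eq_maxrowsub.
(* Basis rows are zeroed, as their entries are already counted in [x]. *)
pose B0 : 'M[F]_(m, \rank A) :=
  (\matrix_(i, l) if i \in codom f then 0 else C i l)%R.
exists (row_mx B0 0%R).
pose g (v : 'cV[F]_m) : 'cV[F]_(\rank A + d) := col_mx (rowsub f v) 0%R.
have vE v : v \in columns A -> v = (C *m rowsub f v)%R.
  move=> /imsetP[j _ ->]; rewrite {1}AE !colE -mulmxA; congr (_ *m _)%R.
  by rewrite -mul_rowsub_mx.
have g_inj : {in columns A &, injective g}.
  by move=> v w vA wA /eq_col_mx[E _]; rewrite (vE v vA) (vE w wA) E.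
rewrite -(card_in_imset g_inj).
apply/subset_leq_card/subsetP => _ /imsetP[v vA ->]; rewrite inE.
rewrite mul_row_col mul0mx addr0.
have <- : weight v = k by case/imsetP: vA => j _ ->.
rewrite !weightE -(cardsID [set i | i \in codom f] (supp v)).
apply/eqP; congr (_ + _).
  rewrite -weightE weight_col_mx0 weightE.
  rewrite -(card_imset _ (@maxrankfun_inj _ _ _ A)).
  apply: eq_card => i; rewrite !inE; apply/imsetP/andP => [[l]|[iv /codomP[l il]]].
    by rewrite inE mxE => vl ->; rewrite codom_f.
  by exists l; rewrite // inE mxE -il.
apply: eq_card => i; rewrite !inE {2}(vE v vA) !mxE.
case: (boolP (i \in codom f)) => /= iB; last first.
  by congr (_ != _); apply: eq_bigr => l _; rewrite !mxE (negPf iB).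
by rewrite big1 ?eqxx // => l _; rewrite mxE iB mul0r.
Qed.

(** * Constructions attaining the bounds *)

Section Attain.
Context {F : finFieldType} {m : nat} (S : {set 'cV[F]_m}).

Definition set_mx : 'M[F]_(m, #|S|) :=
  (\matrix_(i, j) (enum_val j : 'cV[F]_m) i 0)%R.

Lemma col_set_mx j : col j set_mx = enum_val j.
Proof. by apply/colP => i; rewrite !mxE. Qed.

Lemma columns_set_mx : columns set_mx = S.
Proof.
apply/setP => v; apply/imsetP/idP => [[j _ ->]|vS].
  by rewrite col_set_mx enum_valP.
by exists (enum_rank_in vS v); rewrite // col_set_mx enum_rankK_in.
Qed.

Lemma attainable_set_mx r k : (forall v, v \in S -> weight v = k) ->
  \rank set_mx <= r -> attainable F r k #|S|.
Proof.
move=> Sk rS; exists m, #|S|, set_mx; split=> //; last by rewrite columns_set_mx.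
by move=> j; rewrite col_set_mx; apply: Sk; apply: enum_valP.
Qed.

End Attain.

Lemma attainable_sphere (F : finFieldType) r k :
  attainable F r k ('C(r, k) * (#|F| - 1) ^ k).
Proof.
rewrite -card_sphere; apply: attainable_set_mx; last exact: rank_leq_row.
by move=> v; rewrite inE => /eqP.
Qed.

(** All weight-k vectors of length r + 1 lie in the hyperplane of coordinate sum 0, as [k] is even;
    hence rank at most [r]. *)
Lemma attainable_even (F : finFieldType) r k :
  #|F| = 2 -> ~~ odd k -> attainable F r k 'C(r.+1, k).
Proof.
move=> F2 k_even; have := @card_sphere F r.+1 k; rewrite F2 exp1n muln1 => <-.
apply: attainable_set_mx => [v|]; first by rewrite inE => /eqP.
set S := [set v | _].
have : ((const_mx 1 : 'rV[F]_r.+1) *m set_mx S = 0)%R.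
  apply/rowP => j; rewrite !mxE.
  transitivity (\sum_i (enum_val j : 'cV[F]_r.+1) i 0)%R.
    by apply: eq_bigr => i _; rewrite !mxE mul1r.
  have := enum_valP j; rewrite inE => /eqP jk.
  by rewrite F2_sum // jk F2_natr // (negPf k_even).
move/mulmx0_rank_max; rewrite rank_rV.
case: eqP => [/rowP/(_ ord0)|_]; last by rewrite add1n ltnS.
by rewrite !mxE => /eqP; rewrite oner_eq0.
Qed.

Theorem theorem1 :
  forall k : nat, exists R : nat,
    forall (q : nat) (F : finFieldType), #|F| = q ->
    forall r : nat, R <= r ->
      ex F r k = if (q == 2) && ~~ odd k then 'C(r.+1, k)
                 else 'C(r, k) * (q - 1) ^ k.
Proof.
(* The threshold is the one of [sum_bin_leq]; it also leaves the 2k positions that [sol_doubling]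
   requires. *)
move=> k; exists (4 * k * 4 ^ k + 6 * k + 10) => q F Fq r r_large.
rewrite /ex; case: ex_maxnP => N /asboolP[m [n [A [Ak rA <-]]]] N_max.
have [B AB] := columns_sol Ak rA.
apply/eqP; rewrite eqn_leq; apply/andP; split; last first.
  apply: N_max; apply/asboolP; case: ifP => [/andP[/eqP q2 k_even]|_].
    by apply: attainable_even; rewrite // Fq.
  by rewrite -Fq; apply: attainable_sphere.
apply: leq_trans AB _; rewrite -Fq; case: eqP => [F2|/eqP F2] /=.
  case: ifPn => [_|/negPn k_odd]; first exact: sol_le_binary.
  exact: sol_le_binary_odd.
exact: sol_le_large_field.
Qed.
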